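(* Let $a>0$ and let $\nu$ be the Poisson distribution with intensity $a$ on $\mathbb{N}_0$. Let $\{X_n\}_{n\geq 1}$ be a sequence of independent and identically distributed random variables taking values in $\mathbb{N}_0$, with law denoted $\nu_{X_1}$. Suppose that the $X_n$'s have mean $a$ and that $\frac{d\nu_{X_1}}{d\nu}\in\mathcal{L}^2(\mathbb{N}_0,2^{\mathbb{N}_0},\nu)$. Let $U$ be a Poisson random variable with intensity $a$ which is independent of the sequence $\{X_n\}_{n\geq 1}$. Then, for any sequence $\{b_n\}_{n\geq 1}$ of non-negative real numbers such that $$\lim_{n\to+\infty}\frac{b_n}{n}=0\quad\text{and}\quad\lim_{n\to+\infty}\frac{b_n}{n^{1/2}}=+\infty,$$ the density with respect to $\nu$ of (the law of) the random variable $$T_{\frac{n}{n+b_n}}\Big(T_{\frac{1}{n}}X_1+\cdots+T_{\frac{1}{n}}X_n\Big)+T_{\frac{b_n}{n+b_n}}U$$ converges in $\mathcal{L}^1(\mathbb{N}_0,2^{\mathbb{N}_0},\nu)$ to the constant function $1$ as $n$ tends to infinity.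
   Context: $\mathbb{N}_0=\mathbb{N}\cup\{0\}$ is the set of non-negative integers. The Poisson distribution $\nu$ with intensity $a>0$ is $\nu(\{k\})=\frac{a^k}{k!}e^{-a}$, $k\in\mathbb{N}_0$. The density of an $\mathbb{N}_0$-valued random variable with respect to $\nu$ means the Radon–Nikodym derivative of its law with respect to $\nu$. Thinning: for a random variable $X$ with values in $\mathbb{N}_0$ and law $\nu_X$, and for $\alpha\in[0,1]$, the $\alpha$-thinning of $\nu_X$ is the probability measure on $\mathbb{N}_0$ given by $$(T_\alpha\nu_X)(\{k\})=\sum_{m\geq k}\binom{m}{k}\alpha^k(1-\alpha)^{m-k}\nu_X(\{m\}),\quad k\in\mathbb{N}_0$$ (with the convention $0^0=1$). $T_\alpha X$ denotes a random variable with law $T_\alpha\nu_X$; equivalently, it has the law of $Y_1+\cdots+Y_X$, where the $Y_i$'s are Bernoulli random variables with success probability $\alpha$, independent of each other and of $X$. In sums of thinned random variables, the thinnings are performed independently, so that the summands $T_{1/n}X_1,\dots,T_{1/n}X_n$ are independent, and the two terms $T_{n/(n+b_n)}(\cdots)$ and $T_{b_n/(n+b_n)}U$ are independent. *)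

(* Defs.v *)
From HB Require Import structures.
From mathcomp Require Import all_boot all_order all_algebra.
From mathcomp Require Import all_classical all_reals all_analysis.
From mathcomp Require Import measurable_realfun.

Set Implicit Arguments.
Unset Strict Implicit.
Unset Printing Implicit Defensive.

Import Order.TTheory GRing.Theory Num.Theory.
Import numFieldNormedType.Exports.

Local Open Scope classical_set_scope.
Local Open Scope ring_scope.
Local Open Scope ereal_scope.

(* [poisson_prob] carries an unused argument of type [nat], set to 0 here. *)
Definition Poisson {R : realType} (a : R) : probability nat R :=
  poisson_prob a 0.

Section thinning.
Context {R : realType} (alpha : R) (mu : probability nat R).

(* [x ^+ 0 = 1] for every [x], so the convention 0^0 = 1 is built in. *)
Definition thinning_pmf (k : nat) : \bar R :=
  \sum_(k <= m <oo)
    ('C(m, k)%:R * alpha ^+ k * (1 - alpha) ^+ (m - k))%:E * mu [set m].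

(* The value outside of 0 <= alpha <= 1 is irrelevant; as for the laws of the
   library, it is chosen so that [thinning] is always a probability. *)
Definition thinning : set nat -> \bar R := fun A =>
  if (0 <= alpha <= 1)%R then \esum_(k in A) thinning_pmf k else \d_0%N A.

Local Lemma thinning_coef_ge0 m k : (0 <= alpha <= 1)%R ->
  (0 <= 'C(m, k)%:R * alpha ^+ k * (1 - alpha) ^+ (m - k))%R.
Proof.
by move=> /andP[a0 a1]; rewrite !mulr_ge0// exprn_ge0// subr_ge0.
Qed.

Lemma thinning_pmf_ge0 k : (0 <= alpha <= 1)%R -> 0 <= thinning_pmf k.
Proof.
move=> a01; apply: nneseries_ge0 => m _ _.
by rewrite mule_ge0// lee_fin thinning_coef_ge0.
Qed.

Let thinning0 : thinning set0 = 0.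
Proof. by rewrite /thinning measure0; case: ifPn => //; rewrite esum_set0. Qed.

Let thinning_ge0 A : 0 <= thinning A.
Proof.
rewrite /thinning; case: ifPn => // a01; apply: esum_ge0 => k _.
exact: thinning_pmf_ge0.
Qed.

Let thinning_sigma_additive : semi_sigma_additive thinning.
Proof.
move=> F mF tF mUF; rewrite /thinning; case: ifPn => a01; last first.
  exact: measure_semi_sigma_additive.
apply: cvg_toP.
  apply: ereal_nondecreasing_is_cvgn => i j ij.
  apply: lee_sum_nneg_natr => // n _ _.
  by apply: esum_ge0 => k _; exact: thinning_pmf_ge0.
by rewrite nneseries_sum_bigcup// => k; exact: thinning_pmf_ge0.
Qed.

HB.instance Definition _ := isMeasure.Build _ _ _ thinning
  thinning0 thinning_ge0 thinning_sigma_additive.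

Local Lemma thinning_pmfE k : (0 <= alpha <= 1)%R ->
  thinning_pmf k = \sum_(0 <= m <oo)
    ('C(m, k)%:R * alpha ^+ k * (1 - alpha) ^+ (m - k))%:E * mu [set m].
Proof.
move=> a01; rewrite [RHS](nneseries_split _ k); last first.
  by move=> m _; rewrite mule_ge0// lee_fin thinning_coef_ge0.
rewrite add0n big_nat big1 ?add0e// => m /andP[_ mk].
by rewrite bin_small// !mul0r mul0e.
Qed.

Let thinning_setT : thinning [set: nat] = 1.
Proof.
rewrite /thinning; case: ifPn => [a01|_]; last by rewrite probability_setT.
pose c m k := ('C(m, k)%:R * alpha ^+ k * (1 - alpha) ^+ (m - k))%R.
have c0 m k : (0 <= c m k)%R by exact: thinning_coef_ge0.
rewrite -nneseries_esumT; last by move=> k; exact: thinning_pmf_ge0.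
transitivity (\sum_(0 <= k <oo) \sum_(0 <= m <oo) ((c m k)%:E * mu [set m])).
  by apply: eq_eseriesr => k _; exact: thinning_pmfE.
rewrite nneseries_interchange; last by move=> k m; rewrite mule_ge0// lee_fin.
transitivity (\sum_(0 <= m <oo) mu [set m]).
  apply: eq_eseriesr => m _.
  rewrite (nneseries_split _ m.+1); last first.
    by move=> k _; rewrite mule_ge0// lee_fin.
  rewrite add0n [X in _ + X]eseries0 ?adde0; last first.
    by move=> k mk _; rewrite /c bin_small// !mul0r mul0e.
  rewrite big_mkord -ge0_sume_distrl; last by move=> k _; rewrite lee_fin.
  rewrite sumEFin [X in X%:E](_ : _ = 1%R) ?mul1e//.
  rewrite -[RHS](expr1n _ m) -[in RHS](subrK alpha 1%R) exprDn.
  by apply: eq_bigr => k _; rewrite /c -mulrA mulr_natl [in RHS]mulrC.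
rewrite -(probability_setT mu).
have -> : [set: nat] = \bigcup_m [set m] by rewrite bigcup_imset1 image_id.
rewrite measure_bigcup//.
  apply: eq_eseriesl => m; exact/esym/in_setT.
by apply/trivIsetP => i j _ _ ij; apply/disjoints_subset => x -> /=; exact/eqP.
Qed.

HB.instance Definition _ :=
  @Measure_isProbability.Build _ _ R thinning thinning_setT.

End thinning.

Section sum_of_random_variables.
Context d (T : measurableType d).

Definition addRV (X Y : {mfun T >-> nat}) : T -> nat :=
  fun w => (X w + Y w)%N.

Local Lemma measurable_addRV X Y : measurable_fun setT (addRV X Y).
Proof. exact: measurable_fun_addn. Qed.

HB.instance Definition _ X Y :=
  isMeasurableFun.Build _ _ _ _ (addRV X Y) (measurable_addRV X Y).

Definition sumRV n (X : 'I_n -> {mfun T >-> nat}) : T -> nat :=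
  fun w => (\sum_(i < n) X i w)%N.

Local Lemma measurable_sumRV n (X : 'I_n -> {mfun T >-> nat}) :
  measurable_fun setT (sumRV X).
Proof.
elim: n X => [|n IHn] X.
  by rewrite (_ : sumRV X = cst 0%N)//; apply/funext => w; rewrite /sumRV big_ord0.
rewrite (_ : sumRV X = (fun w => sumRV (X \o lift ord0) w + X ord0 w)%N).
  exact: measurable_fun_addn.
by apply/funext => w; rewrite /sumRV big_ord_recl addnC.
Qed.

HB.instance Definition _ n (X : 'I_n -> {mfun T >-> nat}) :=
  isMeasurableFun.Build _ _ _ _ (sumRV X) (measurable_sumRV X).

End sum_of_random_variables.

Section independence.
Context d d' (T : measurableType d) (T' : measurableType d') (R : realType).
Variable P : probability T R.

Definition mutually_independent (I : eqType) (X : I -> {mfun T >-> T'}) : Prop :=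
  forall (s : seq I) (A : I -> set T'), uniq s ->
    (forall i, measurable (A i)) ->
    P (\bigcap_(i in [set` s]) (X i @^-1` A i)) =
    \prod_(i <- s) P (X i @^-1` A i).

Definition independentRV (X Y : {mfun T >-> T'}) : Prop :=
  forall A B, measurable A -> measurable B ->
    P (X @^-1` A `&` Y @^-1` B) = P (X @^-1` A) * P (Y @^-1` B).

Definition sigma_family (I : Type) (X : I -> {mfun T >-> T'}) : set (set T) :=
  <<s \bigcup_(i in [set: I]) preimage_set_system setT (X i) measurable >>.

Definition independent_of_family (I : Type) (U : {mfun T >-> T'})
    (X : I -> {mfun T >-> T'}) : Prop :=
  forall A C, measurable A -> sigma_family X C ->
    P (U @^-1` A `&` C) = P (U @^-1` A) * P C.

End independence.

(* The Radon-Nikodym derivative of [mu] with respect to [nu]; it is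
   finite-valued whenever [mu `<< nu], so that [fine] loses nothing. *)
Definition density {d} {T : measurableType d} {R : realType}
    (mu nu : probability T R) : T -> R :=
  fine \o Radon_Nikodym (charge_of_finite_measure mu) nu.

Lemma dominates_Poisson (R : realType) (a : R) (mu : probability nat R) :
  (0 < a)%R -> mu `<< Poisson a.
Proof.
move=> a0; apply/null_content_dominatesP => A _.
have [->|/set0P[k Ak]] := eqVneq A set0; first by rewrite measure0.
move=> A0; exfalso; move: A0; apply/eqP; rewrite gt_eqF//.
apply: (@lt_le_trans _ _ (Poisson a [set k])); last first.
  by apply: le_measure; rewrite ?inE// => _ ->.
rewrite /Poisson /= /poisson_prob a0 esum_set1 ?lee_fin ?poisson_pmf_ge0//.
by rewrite lte_fin /poisson_pmf a0 !mulr_gt0// ?exprn_gt0 ?expR_gt0 ?invr_gt0 ?ltr0n ?fact_gt0.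
Qed.

(* Main.v *)
Require Import Defs.
From HB Require Import structures.
From mathcomp Require Import all_boot all_order all_algebra.
From mathcomp Require Import ring lra.
From mathcomp Require Import all_classical all_reals all_analysis.

Set Implicit Arguments.
Unset Strict Implicit.
Unset Printing Implicit Defensive.

Import Order.TTheory GRing.Theory Num.Theory.
Import numFieldNormedType.Exports.

Local Open Scope classical_set_scope.
Local Open Scope ring_scope.

(** The norm to be estimated is the l1 distance, on [nat], between the mass
function of the law of the random variable and that of the Poisson
distribution ([Lnorm1_density]).  It is bounded by comparing each ingredient
of the random variable with a Poisson law of the same mean.

Thinning and convolution with a fixed law are both pushforwards by a Markov
kernel, hence contract the l1 distance ([l1_kernel]).  They also preserve the
Poisson family: the [alpha]-thinning of Poisson(t) is Poisson(alpha t), and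
Poisson(s) * Poisson(t) = Poisson(s + t).  Since the two thinning parameters
n/(n+b) and b/(n+b) add up to 1, the Poisson law of mean [a] is obtained from
itself by the same thinnings and addition as in the statement, so that the
distance to be estimated is at most the distance between the law of the sum
of the [T_{1/n} X_i] and Poisson(a).  Both are n-fold convolutions, so this distance is in turn at most [n] times the distance
between the law of [T_{1/n} X_1] and Poisson(a/n) ([l1_sumRV_pois]).

This last distance is o(1/n).  By Bernoulli's inequality, [T_{1/n} X_1]
vanishes with probability at least 1 - a/n, as does Poisson(a/n); two such
laws can only be far apart if one of them puts mass much less than a/n
on 1 ([l1_rare]).  But [n P(T_{1/n} X_1 = 1) = E (X_1 (1 - 1/n)^(X_1 - 1))]
tends to [E X_1 = a] by dominated convergence ([cvg_mass_thinning1]). *)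

(** * Kernels contract the l1 distance *)

Section l1_distance.
Context {R : realType}.
Implicit Types (u v : nat -> R) (K : nat -> nat -> R).

Definition l1 u v : \bar R := (\sum_(k <oo) `|u k - v k|%:E)%E.

Lemma l1C u v : l1 u v = l1 v u.
Proof. by apply: eq_eseriesr => k _; rewrite distrC. Qed.

Lemma l1xx u : l1 u u = 0%E.
Proof. by apply: eseries0 => k _ _; rewrite subrr normr0. Qed.

Lemma l1_triangle v u w : (l1 u w <= l1 u v + l1 v w)%E.
Proof.
rewrite /l1 -nneseriesD//; apply: lee_nneseries => // k _.
by rewrite -EFinD lee_fin ler_distD.
Qed.

Lemma nneseries_if_lt (n : nat) u : (forall k, 0 <= u k) ->
  (\sum_(k <oo) (if (k < n)%N then u k else 0)%:E)%E = (\sum_(k < n) u k)%:E.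
Proof.
move=> u0; rewrite (nneseries_split _ n); last first.
  by move=> k _; rewrite lee_fin; case: ifP.
rewrite add0n [X in (_ + X)%E]eseries0 ?adde0; last first.
  by move=> k nk _; rewrite ltnNge nk.
by rewrite big_mkord -sumEFin; apply: eq_bigr => k _; rewrite ltn_ord.
Qed.

Lemma nneseries_if_ge (n : nat) (u : nat -> \bar R) : (forall k, (0 <= u k)%E) ->
  (\sum_(k <oo) (if (n <= k)%N then u (k - n)%N else 0))%E =
  (\sum_(k <oo) u k)%E.
Proof.
move=> u0; rewrite (nneseries_split _ n); last by move=> k _; case: ifP.
rewrite big_nat big1 ?add0e => [|k /andP[_ kn]]; last by rewrite leqNgt kn.
rewrite -nneseries_addn; last by move=> k; case: ifP.
by apply: eq_eseriesr => k _; rewrite add0n leq_addl addnK.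
Qed.

(** If [u'] and [v'] are the images of [u] and [v] under the Markov kernel [K],
then |u' - v'| is at most the image of |u - v|, whose total mass is that of
|u - v| since the rows of [K] sum to 1. *)
Lemma l1_kernel K u v u' v' :
  (forall m k, 0 <= K m k) -> (forall m, (\sum_(k <oo) (K m k)%:E = 1)%E) ->
  (forall m, 0 <= u m) -> (forall m, 0 <= v m) ->
  (forall k, (u' k)%:E = (\sum_(m <oo) (K m k * u m)%:E)%E) ->
  (forall k, (v' k)%:E = (\sum_(m <oo) (K m k * v m)%:E)%E) ->
  (l1 u' v' <= l1 u v)%E.
Proof.
move=> K0 K1 u0 v0 Eu Ev.
pose w m := `|u m - v m|.
have wE k : (`|u' k - v' k|%:E <= \sum_(m <oo) (K m k * w m)%:E)%E.
  (* Each of the two signs of the difference is bounded by comparing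
     nonnegative series: p <= q + |u - v| termwise. *)
  have half (p q p' q' : nat -> R) : (forall m, 0 <= p m) ->
      (forall m, 0 <= q m) -> (forall m, p m <= q m + w m) ->
      (p' k)%:E = (\sum_(m <oo) (K m k * p m)%:E)%E ->
      (q' k)%:E = (\sum_(m <oo) (K m k * q m)%:E)%E ->
      ((p' k - q' k)%:E <= \sum_(m <oo) (K m k * w m)%:E)%E.
    move=> p0 q0 pq Ep Eq; rewrite EFinB leeBlDl// Ep Eq -nneseriesD; first last.
    - by move=> m _ _; rewrite lee_fin mulr_ge0 ?/w.
    - by move=> m _ _; rewrite lee_fin mulr_ge0.
    apply: lee_nneseries => m _; first by rewrite lee_fin mulr_ge0.
    by rewrite -EFinD lee_fin -mulrDr ler_wpM2l.
  case: (ger0P (u' k - v' k)) => _; last rewrite opprB.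
    by apply: (half u v u' v') => // m; rewrite -lerBlDl; exact: ler_norm.
  by apply: (half v u v' u') => // m; rewrite -lerBlDl /w distrC; exact: ler_norm.
apply: (@le_trans _ _ (\sum_(k <oo) \sum_(m <oo) (K m k * w m)%:E)%E).
  by apply: lee_nneseries.
rewrite (nneseries_interchange xpredT xpredT); last first.
  by move=> i j; rewrite lee_fin mulr_ge0 ?/w.
apply: lee_nneseries => m _.
  by move=> _; apply: nneseries_ge0 => k _ _; rewrite lee_fin mulr_ge0 ?/w.
under eq_eseriesr do rewrite mulrC EFinM.
by rewrite nneseriesZl ?K1 ?mule1//= => k _; rewrite lee_fin.
Qed.

End l1_distance.

(** * Convolution of mass functions *)

Section convolution.
Context {R : realType}.
Implicit Types u v p : nat -> R.

Definition convolve u v (k : nat) : R := \sum_(l < k.+1) u l * v (k - l)%N.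

Lemma convolveC u v : convolve u v =1 convolve v u.
Proof.
move=> k; rewrite /convolve (reindex_inj rev_ord_inj)/=; apply: eq_bigr => l _.
by rewrite subSS mulrC subKn// -ltnS.
Qed.

Lemma convolve_ge0 u v : (forall k, 0 <= u k) -> (forall k, 0 <= v k) ->
  forall k, 0 <= convolve u v k.
Proof. by move=> u0 v0 k; apply: sumr_ge0 => l _; exact: mulr_ge0. Qed.

(** Convolution with [p] is the Markov kernel that moves [m] to [m + j] with
probability [p j]. *)
Lemma l1_convolver p u v :
  (forall k, 0 <= p k) -> (\sum_(k <oo) (p k)%:E = 1)%E ->
  (forall k, 0 <= u k) -> (forall k, 0 <= v k) ->
  (l1 (convolve u p) (convolve v p) <= l1 u v)%E.
Proof.
move=> p0 p1 u0 v0.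
pose K m k := if (m <= k)%N then p (k - m)%N else 0.
have convolveE w : (forall k, 0 <= w k) ->
    forall k, (convolve w p k)%:E = (\sum_(m <oo) (K m k * w m)%:E)%E.
  move=> w0 k; rewrite -(@nneseries_if_lt _ k.+1 (fun l => w l * p (k - l)%N)).
    by apply: eq_eseriesr => m _; rewrite /K ltnS; case: ifP; rewrite ?mul0r// mulrC.
  by move=> l; exact: mulr_ge0.
apply: (@l1_kernel _ K) => //; last 2 first.
- exact: convolveE.
- exact: convolveE.
- by move=> m k; rewrite /K; case: ifP.
- move=> m; rewrite -p1 -(@nneseries_if_ge _ m (EFin \o p))/=; last first.
    by move=> k; rewrite lee_fin.
  by apply: eq_eseriesr => k _; rewrite /K; case: ifP.
Qed.

(** The hybrid argument: replace the left factors, then the right ones.  Each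
step convolves with a fixed law, which is why only [u'] and [v] have to have
total mass 1. *)
Lemma l1_convolve u v u' v' :
  (forall k, 0 <= u k) -> (forall k, 0 <= v k) ->
  (forall k, 0 <= u' k) -> (forall k, 0 <= v' k) ->
  (\sum_(k <oo) (u' k)%:E = 1)%E -> (\sum_(k <oo) (v k)%:E = 1)%E ->
  (l1 (convolve u u') (convolve v v') <= l1 u v + l1 u' v')%E.
Proof.
move=> u0 v0 u'0 v'0 u'1 v1.
apply: (le_trans (l1_triangle (convolve v u') _ _)); apply: leeD.
  exact: l1_convolver.
rewrite (_ : convolve v u' = convolve u' v); last exact/funext/convolveC.
rewrite (_ : convolve v v' = convolve v' v); last exact/funext/convolveC.
exact: l1_convolver.
Qed.

End convolution.

(** * Poisson and binomial weights *)

Section poisson_weights.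
Context {R : realType}.
Implicit Types s t : R.

(** Unlike [poisson_pmf], which is constant equal to 1 for a nonpositive rate,
this is the unit mass at 0 for [t = 0]. This makes [convolve_pois] and
[thin_pois] valid in the degenerate cases, and [pois 0] the neutral element
of [convolve]. *)
Definition pois t (k : nat) : R := t ^+ k / k`!%:R * expR (- t).

Lemma pois_ge0 t k : 0 <= t -> 0 <= pois t k.
Proof. by move=> t0; rewrite !mulr_ge0 ?exprn_ge0 ?invr_ge0 ?expR_ge0. Qed.

Lemma nneseries_exp t : 0 <= t ->
  (\sum_(k <oo) (t ^+ k / k`!%:R)%:E = (expR t)%:E)%E.
Proof.
move=> t0; rewrite /expR -EFin_lim; last exact: is_cvg_series_exp_coeff.
by apply/congr_lim/funext => n/=; rewrite /series/= -sumEFin.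
Qed.

Lemma nneseries_pois t : 0 <= t -> (\sum_(k <oo) (pois t k)%:E = 1)%E.
Proof.
move=> t0; under eq_eseriesr do rewrite /pois mulrC EFinM.
rewrite nneseriesZl; last by move=> k _; rewrite lee_fin divr_ge0 ?exprn_ge0.
by rewrite nneseries_exp// -EFinM -expRD addNr expR0.
Qed.

Lemma bin_div_fact (m k : nat) : (k <= m)%N ->
  'C(m, k)%:R / m`!%:R = k`!%:R^-1 * (m - k)`!%:R^-1 :> R.
Proof.
move=> km; rewrite -(bin_fact km) !natrM.
have f0 (n : nat) : n`!%:R != 0 :> R by rewrite pnatr_eq0 -lt0n fact_gt0.
have C0 : 'C(m, k)%:R != 0 :> R by rewrite pnatr_eq0 -lt0n bin_gt0.
by field; rewrite C0 !f0.
Qed.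

(** The binomial formula for (s + t)^k. *)
Lemma convolve_pois s t : convolve (pois s) (pois t) =1 pois (s + t).
Proof.
move=> k; rewrite /convolve /pois [s + t]addrC exprDn opprD expRD !mulr_suml.
apply: eq_bigr => l _.
have lk : (l <= k)%N by rewrite -ltnS.
transitivity ('C(k, l)%:R / k`!%:R * (t ^+ (k - l) * s ^+ l) *
  (expR (- t) * expR (- s))); last by rewrite -[in RHS]mulr_natr; ring.
by rewrite (bin_div_fact lk); ring.
Qed.

Definition bin_weight (alpha : R) (m k : nat) : R :=
  'C(m, k)%:R * alpha ^+ k * (1 - alpha) ^+ (m - k).

Lemma bin_weight_ge0 (alpha : R) m k : 0 <= alpha <= 1 ->
  0 <= bin_weight alpha m k.
Proof.
by move=> /andP[a0 a1]; rewrite /bin_weight !mulr_ge0// exprn_ge0// subr_ge0.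
Qed.

Lemma nneseries_bin_weight (alpha : R) m : 0 <= alpha <= 1 ->
  (\sum_(k <oo) (bin_weight alpha m k)%:E = 1)%E.
Proof.
move=> a01; transitivity
    (\sum_(k <oo) (if (k < m.+1)%N then bin_weight alpha m k else 0)%:E)%E.
  apply: eq_eseriesr => k _; case: ltnP => // mk.
  by rewrite /bin_weight bin_small// !mul0r.
rewrite nneseries_if_lt; last by move=> k; exact: bin_weight_ge0.
congr (_%:E); rewrite -[RHS](expr1n _ m) -[in RHS](subrK alpha 1) exprDn.
by apply: eq_bigr => k _; rewrite /bin_weight -mulrA mulr_natl [in RHS]mulrC.
Qed.

(** With m = k + j, the binomial coefficient cancels the factorial of m, and
what remains is the series of exp((1 - alpha) t). *)
Lemma thin_pois (alpha t : R) k : 0 <= alpha <= 1 -> 0 <= t ->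
  (pois (alpha * t) k)%:E =
  (\sum_(m <oo) (bin_weight alpha m k * pois t m)%:E)%E.
Proof.
move=> a01 t0; have /andP[a0 a1] := a01.
pose r := (1 - alpha) * t; have r0 : 0 <= r by rewrite mulr_ge0// subr_ge0.
pose c := (alpha * t) ^+ k / k`!%:R * expR (- t).
transitivity (\sum_(m <oo) (if (k <= m)%N then
    (c%:E * (r ^+ (m - k) / (m - k)`!%:R)%:E) else 0))%E; last first.
  apply: eq_eseriesr => m _; case: leqP => [km|mk]; last first.
    by rewrite /bin_weight bin_small// !mul0r.
  rewrite -EFinM; congr (_%:E); rewrite /bin_weight /pois /c /r !exprMn.
  have -> : t ^+ m = t ^+ k * t ^+ (m - k) by rewrite -exprD subnKC.
  transitivity ('C(m, k)%:R / m`!%:R * (alpha ^+ k * (1 - alpha) ^+ (m - k) *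
    (t ^+ k * t ^+ (m - k)) * expR (- t))); last by ring.
  by rewrite (bin_div_fact km); ring.
rewrite (@nneseries_if_ge _ k (fun j => c%:E * (r ^+ j / j`!%:R)%:E)%E).
  rewrite nneseriesZl; last by move=> j _; rewrite lee_fin divr_ge0 ?exprn_ge0.
  rewrite nneseries_exp// -EFinM; congr (_%:E).
  rewrite /pois /c -[RHS]mulrA -expRD; congr (_ * expR _); rewrite /r; ring.
move=> j; rewrite -EFinM lee_fin mulr_ge0 ?divr_ge0 ?exprn_ge0//.
by rewrite mulr_ge0 ?expR_ge0// divr_ge0// exprn_ge0// mulr_ge0.
Qed.

End poisson_weights.

(** * Laws concentrated at 0 and 1 *)

Section rare_events.
Context {R : realType}.
Implicit Types (p q : nat -> R) (t : R).

Definition bern t (k : nat) : R :=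
  match k with 0%N => 1 - t | 1%N => t | _ => 0 end.

(** The excess of [p] at 0, the defect of [p] at 1 and the mass of [p] beyond 1
are all determined by [p 0] and [p 1], and the contributions of [p 0]
cancel out. *)
Lemma l1_bernoulli p t : (forall k, 0 <= p k) -> (\sum_(k <oo) (p k)%:E = 1)%E ->
  1 - t <= p 0%N ->
  l1 p (bern t) = (2 * (t - p 1%N))%:E.
Proof.
move=> p0 p1 tp.
have split2 f : (forall k, 0 <= f k :> R) -> (\sum_(k <oo) (f k)%:E =
    (f 0%N + f 1%N)%:E + \sum_(2 <= k <oo) (f k)%:E)%E.
  move=> f0; rewrite (nneseries_split 0 2)//; last by move=> k _; rewrite lee_fin.
  by rewrite add0n big_mkord !big_ord_recr big_ord0/= add0e.
have tail : (\sum_(2 <= k <oo) (p k)%:E = (1 - p 0%N - p 1%N)%:E)%E.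
  move: p1; rewrite split2//.
  case: (X in (_ + X)%E) => [r| |]//; rewrite -EFinD => -[<-].
  by congr (_%:E); ring.
have tail0 : 0 <= 1 - p 0%N - p 1%N.
  by rewrite -lee_fin -tail; apply: nneseries_ge0 => k _ _; rewrite lee_fin.
rewrite /l1 (split2 (fun k => `|_|))//.
rewrite (_ : (\sum_(2 <= k <oo) _)%E = (1 - p 0%N - p 1%N)%:E); last first.
  rewrite -tail -!(nneseries_addn 2); first last.
  - by move=> i; rewrite lee_fin.
  - by move=> i; rewrite lee_fin.
  by apply: eq_eseriesr => k _; rewrite addn2/= subr0 ger0_norm.
rewrite -EFinD; congr (_%:E).
rewrite /= (ger0_norm (x := p 0%N - _)) ?subr_ge0//.
have pt : p 1%N - t <= 0 by lra.
by rewrite (ler0_norm pt); lra.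
Qed.

(** Both laws are compared with [bern t]. *)
Lemma l1_rare p q t :
  (forall k, 0 <= p k) -> (\sum_(k <oo) (p k)%:E = 1)%E ->
  (forall k, 0 <= q k) -> (\sum_(k <oo) (q k)%:E = 1)%E ->
  1 - t <= p 0%N -> 1 - t <= q 0%N ->
  (l1 p q <= (2 * (t - p 1%N) + 2 * (t - q 1%N))%:E)%E.
Proof.
move=> p0 p1 q0 q1 tp tq; apply: (le_trans (l1_triangle (bern t) _ _)).
by rewrite EFinD -(l1_bernoulli p0)// -(l1_bernoulli q0)// leeD// l1C.
Qed.

End rare_events.

(** * Mass functions of probability laws on the natural numbers *)

Section mass.
Context {R : realType}.
Implicit Types mu : probability nat R.

Definition mass mu (k : nat) : R := fine (mu [set k]).

Lemma massE mu k : (mass mu k)%:E = mu [set k].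
Proof. by rewrite fineK// fin_num_measure. Qed.

Lemma mass_ge0 mu k : 0 <= mass mu k.
Proof. by rewrite fine_ge0. Qed.

Lemma ge0_integral_mass mu (f : nat -> R) : (forall k, 0 <= f k) ->
  (\int[mu]_k (f k)%:E = \sum_(k <oo) (f k * mass mu k)%:E)%E.
Proof.
move=> f0.
have -> : [set: nat] = \bigcup_m [set m] by rewrite bigcup_imset1 image_id.
rewrite ge0_integral_bigcup//.
- apply: eq_eseriesr => k _; rewrite EFinM massE -integral_cst//.
  by apply: eq_integral => m; rewrite inE => ->.
- by move=> k _; rewrite lee_fin.
- by apply/trivIsetP => i j _ _ ij; apply/disjoints_subset => x -> /=; exact/eqP.
Qed.

Lemma nneseries_mass mu : (\sum_(k <oo) (mass mu k)%:E = 1)%E.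
Proof.
under eq_eseriesr do rewrite -[mass _ _]mul1r.
rewrite -(@ge0_integral_mass mu (fun=> 1))//.
rewrite (@integral_cst _ nat R mu [set: nat] measurableT 1%E) mul1e.
exact: probability_setT.
Qed.

Lemma mass_thinning (alpha : R) mu k : 0 <= alpha <= 1 ->
  (mass (thinning alpha mu) k)%:E =
  (\sum_(m <oo) (bin_weight alpha m k * mass mu m)%:E)%E.
Proof.
move=> a01; rewrite massE/= /thinning a01 esum_set1; last first.
  exact: thinning_pmf_ge0.
rewrite Defs.thinning_pmfE//; apply: eq_eseriesr => m _.
by rewrite [in RHS]EFinM massE.
Qed.

Lemma mass_Poisson (a : R) k : 0 < a -> mass (Poisson a) k = pois a k.
Proof.
move=> a0; rewrite /mass /Poisson/= /poisson_prob a0 esum_set1/=.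
  by rewrite /poisson_pmf a0.
by rewrite lee_fin poisson_pmf_ge0.
Qed.

(** On a singleton, the Radon-Nikodym identity reads mu(k) = f(k) nu(k), so that
|f(k) - 1| nu(k) = |mu(k) - nu(k)|. *)
Lemma Lnorm1_density (a : R) mu : 0 < a ->
  ('N[Poisson a]_1[EFin \o (fun k => density mu (Poisson a) k - 1)%R] =
   l1 (mass mu) (pois a))%E.
Proof.
move=> a0; rewrite Lnorm1/= ge0_integral_mass//; apply: eq_eseriesr => k _.
have dom := dominates_Poisson mu a0.
have RN : mass mu k = density mu (Poisson a) k * mass (Poisson a) k.
  apply: EFin_inj; rewrite EFinM !massE /density/= fineK; last first.
    exact: Radon_Nikodym_fin_num.
  rewrite -integral_cst//.
  transitivity (charge_of_finite_measure mu [set k]); first by [].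
  rewrite (@Radon_Nikodym_integral _ _ _ (charge_of_finite_measure mu)
    (Poisson a))//.
  by apply: eq_integral => m; rewrite inE => ->.
rewrite -(mass_Poisson _ a0) RN -{3}[mass (Poisson a) k]mul1r -mulrBl normrM.
by rewrite (ger0_norm (mass_ge0 _ k)).
Qed.

Lemma l1_thinning_pois (alpha t : R) mu : 0 <= alpha <= 1 -> 0 <= t ->
  (l1 (mass (thinning alpha mu)) (pois (alpha * t)) <= l1 (mass mu) (pois t))%E.
Proof.
move=> a01 t0; apply: (@l1_kernel _ (bin_weight alpha)).
- by move=> m k; exact: bin_weight_ge0.
- by move=> m; exact: nneseries_bin_weight.
- exact: mass_ge0.
- by move=> m; exact: pois_ge0.
- by move=> k; exact: mass_thinning.
- by move=> k; exact: thin_pois.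
Qed.

(** Laws are compared in the applications as set functions, whereas [mass] takes
a probability, that is, a set function packed with proofs. *)
Lemma eq_mass mu mu' : (mu : set nat -> \bar R) = mu' -> mass mu = mass mu'.
Proof. by move=> E; apply/funext => k; rewrite /mass E. Qed.

Lemma eq_mass_thinning (alpha : R) mu mu' : 0 <= alpha <= 1 ->
  mass mu = mass mu' -> mass (thinning alpha mu) = mass (thinning alpha mu').
Proof.
move=> a01 E; apply/funext => k; apply: EFin_inj.
by rewrite !mass_thinning// E.
Qed.

Lemma mass_thinning_Poisson (alpha t : R) : 0 <= alpha <= 1 -> 0 < t ->
  mass (thinning alpha (Poisson t)) = pois (alpha * t).
Proof.
move=> a01 t0; apply/funext => k; apply: EFin_inj.
rewrite mass_thinning// (thin_pois _ a01 (ltW t0)).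
by apply: eq_eseriesr => m _; rewrite mass_Poisson.
Qed.

End mass.

(** * Sums of independent random variables *)

Section independent_sums.
Context d (T : measurableType d) (R : realType) (P : probability T R).

Lemma measurable_natRV (X : {mfun T >-> nat}) (A : set nat) :
  measurable (X @^-1` A).
Proof. by rewrite -[X in measurable X]setTI; exact: measurable_funPT. Qed.

Lemma probability_sum_split (X : {mfun T >-> nat}) (S : T -> nat) (E : set T)
    (k : nat) : measurable E -> (forall m, measurable (S @^-1` [set m])) ->
  P ([set w | (X w + S w)%N = k] `&` E) =
  (\sum_(l < k.+1)
     P (S @^-1` [set (k - l)%N] `&` (X @^-1` [set nat_of_ord l] `&` E)))%E.
Proof.
move=> mE mS.
pose F l := S @^-1` [set (k - l)%N] `&` (X @^-1` [set l] `&` E).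
rewrite -(@measure_bigsetU _ _ _ P F); first last.
- apply/trivIsetP => i j _ _ ij; apply/disjoints_subset => w/= [_ [Xi _]] [_ [Xj _]].
  by move/eqP: ij; apply; rewrite -Xi -Xj.
- move=> l; apply: measurableI => //; apply: measurableI => //.
  exact: measurable_natRV.
rewrite -bigcup_mkord; congr (P _); apply/seteqP; split=> w/=.
  move=> [XSk Ew]; exists (X w); first by rewrite /= ltnS -XSk leq_addr.
  by split => //=; rewrite -XSk addKn.
by move=> [l /= lk [Sw [Xw Ew]]]; split => //; rewrite Xw Sw subnKC.
Qed.

Lemma mass_distribution (X : {mfun T >-> nat}) k :
  (mass (distribution P X) k)%:E = P (X @^-1` [set k]).
Proof. by rewrite massE. Qed.

Lemma mass_addRV (X Y : {mfun T >-> nat}) : independentRV P X Y ->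
  mass (distribution P (addRV X Y)) =1
  convolve (mass (distribution P X)) (mass (distribution P Y)).
Proof.
move=> XY k; apply: EFin_inj; rewrite mass_distribution -sumEFin.
rewrite (_ : _ @^-1` _ = [set w | (X w + Y w)%N = k] `&` setT); last first.
  by rewrite setIT.
rewrite probability_sum_split//; last by move=> m; exact: measurable_natRV.
apply: eq_bigr => l _; rewrite setIT setIC XY//.
by rewrite EFinM !mass_distribution.
Qed.

Lemma measurable_sum_seq (I : Type) (X : I -> {mfun T >-> nat}) (s : seq I) :
  measurable_fun setT (fun w => \sum_(i <- s) X i w)%N.
Proof.
elim: s => [|i s IHs].
  by rewrite (_ : (fun _ => _) = cst 0%N)//; apply/funext => w; rewrite big_nil.
rewrite (_ : (fun _ => _) = (fun w => X i w + \sum_(j <- s) X j w)%N).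
  exact: measurable_realfun.measurable_fun_addn.
by apply/funext => w; rewrite big_cons.
Qed.

(** For [t] empty, the law of an independent sum is the iterated convolution of
the laws.  The induction on [s] needs the events on the variables indexed by
[t]: to split the sum according to the value [l] of its first term, the
event [X i = l] is added to them. *)
Lemma mass_independent_sum (I : eqType) (X : I -> {mfun T >-> nat})
    (s t : seq I) (A : I -> set nat) (k : nat) :
  mutually_independent P X -> uniq (s ++ t) ->
  (P ([set w | (\sum_(i <- s) X i w)%N = k] `&`
      \bigcap_(i in [set` t]) (X i @^-1` A i)) =
   (foldr (fun i => convolve (mass (distribution P (X i)))) (pois 0) s k)%:E *
   \prod_(i <- t) P (X i @^-1` A i))%E.
Proof.
move=> indepX; elim: s t A k => [|i s IHs] t A k /= st.
  rewrite /pois oppr0 expR0 mulr1 expr0n; case: k => [|k].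
    rewrite fact0 divr1 mul1e -indepX//; congr (P _).
    by apply/seteqP; split => w /=; rewrite big_nil; tauto.
  rewrite mul0r mul0e (_ : _ `&` _ = set0) ?measure0//.
  by apply/seteqP; split => w //=; rewrite big_nil => -[].
have [/andP[ist ust] ust'] :
    (i \notin s ++ t) && uniq (s ++ t) /\ uniq (s ++ i :: t).
  by split => //; rewrite -cat_rcons -cats1 -catA uniq_catCA.
have it : i \notin t by move: ist; rewrite mem_cat negb_or => /andP[].
rewrite (_ : [set w | _] =
    [set w | (X i w + \sum_(j <- s) X j w)%N = k]); last first.
  by apply/seteqP; split => w /=; rewrite big_cons.
rewrite probability_sum_split; first last.
- move=> m; rewrite -[X in measurable X]setTI.
  exact: measurable_sum_seq.
- apply: fin_bigcap_measurable; first exact: finite_seq.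
  by move=> j _; exact: measurable_natRV.
rewrite -sumEFin ge0_sume_distrl; last first.
  move=> l _; rewrite lee_fin mulr_ge0 ?mass_ge0//.
  elim: (s) (k - l)%N => [|j r IHr] m /=; first exact: pois_ge0.
  by apply: convolve_ge0 => // n; exact: mass_ge0.
apply: eq_bigr => l _; rewrite mulrC EFinM -muleA.
pose A' j := if j == i then [set nat_of_ord l] else A j.
have A'i : A' i = [set nat_of_ord l] by rewrite /A' eqxx.
have A'A : {in t, A' =1 A}.
  by move=> j jt; rewrite /A'; case: eqP => // ji; move: it; rewrite -ji jt.
have := IHs (i :: t) A' (k - l)%N ust'.
rewrite big_cons A'i -mass_distribution.
rewrite (_ : \prod_(j <- t) _ = \prod_(j <- t) P (X j @^-1` A j))%E; last first.
  by apply: eq_big_seq => j jt; rewrite A'A.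
move=> <-; congr (P (_ `&` _)).
apply/seteqP; split => w /=.
  move=> [Xl XA] j /=; rewrite inE => /predU1P[->|jt]; first by rewrite A'i.
  by rewrite A'A//; exact: XA.
move=> XA; split; first by have := XA i; rewrite A'i /= mem_head; exact.
by move=> j jt; have := XA j; rewrite /= inE jt orbT A'A//; exact.
Qed.

End independent_sums.

(** * The thinned sum is close to Poisson *)

Section sums_of_rare_events.
Context d (T : measurableType d) (R : realType) (P : probability T R).

(** Poisson(n t) is the n-fold convolution of Poisson(t), and the errors add up
along iterated convolutions by [l1_convolve]. *)
Lemma l1_sumRV_pois n (X : 'I_n -> {mfun T >-> nat}) (t e : R) : 0 <= t ->
  mutually_independent P X ->
  (forall i, (l1 (mass (distribution P (X i))) (pois t) <= e%:E)%E) ->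
  (l1 (mass (distribution P (sumRV X))) (pois (n%:R * t)) <= (n%:R * e)%:E)%E.
Proof.
move=> t0 indepX Xe.
pose law s := foldr (fun i => convolve (mass (distribution P (X i)))) (pois 0) s.
have law_ge0 s k : 0 <= law s k.
  elim: s k => [|i s IHs] k /=; first exact: pois_ge0.
  by apply: convolve_ge0 => // m; exact: mass_ge0.
have -> : mass (distribution P (sumRV X)) = law (index_enum 'I_n).
  apply/funext => k; apply: EFin_inj; rewrite mass_distribution.
  have := @mass_independent_sum _ _ _ P _ X (index_enum 'I_n) [::] (fun=> set0) k.
  rewrite cats0 index_enum_uniq big_nil mule1 => <- //; congr (P _).
  by apply/seteqP; split => w /=; [by move=> ?; split | case].
have -> : n%:R = (size (index_enum 'I_n))%:R :> R.
  by rewrite -{1}(card_ord n) cardT enumT.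
elim: (index_enum _) => [|i s IHs]; first by rewrite !mul0r l1xx.
rewrite /= (_ : convolve _ _ = convolve (law s) (mass (distribution P (X i)))).
  rewrite -natr1 !mulrDl !mul1r EFinD.
  rewrite (_ : pois (_ + _) = convolve (pois ((size s)%:R * t)) (pois t)).
    apply: (le_trans (l1_convolve _ _ _ _ _ _)) => //; last exact: leeD.
    - by move=> k; apply: pois_ge0; rewrite mulr_ge0.
    - exact: mass_ge0.
    - by move=> k; apply: pois_ge0.
    - exact: nneseries_mass.
    - by apply: nneseries_pois; rewrite mulr_ge0.
  by apply/funext => k; rewrite convolve_pois.
by apply/funext => k; rewrite convolveC.
Qed.

End sums_of_rare_events.

(** * Thinning with a small parameter *)

Section thinning_rates.
Context {R : realType}.
Context (mu : probability nat R) (a : R)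
  (mean_mu : (\int[mu]_k (k%:R : R)%:E = a%:E)%E).

Lemma bernoulli_ineq (x : R) m : 0 <= x <= 1 -> 1 - m%:R * x <= (1 - x) ^+ m.
Proof.
move=> /andP[x0 x1]; elim: m => [|m IHm]; first by rewrite mul0r subr0.
rewrite exprSr; apply: (@le_trans _ _ ((1 - m%:R * x) * (1 - x))).
  rewrite -natr1 -subr_ge0 (_ : _ - _ = m%:R * (x * x)); last by ring.
  by rewrite !mulr_ge0.
by rewrite ler_wpM2r// subr_ge0.
Qed.

(** [T_alpha X] vanishes with probability E((1 - alpha)^X), to which Bernoulli's
inequality applies inside the expectation. *)
Lemma mass_thinning0_ge (alpha : R) : 0 <= alpha <= 1 ->
  1 - alpha * a <= mass (thinning alpha mu) 0.
Proof.
move=> a01; have /andP[a0 a1] := a01.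
rewrite lerBlDr -lee_fin EFinD mass_thinning// EFinM -mean_mu.
rewrite -(nneseries_mass mu) ge0_integral_mass// -nneseriesZl; last first.
  by move=> k _; rewrite lee_fin mulr_ge0 ?mass_ge0.
rewrite -nneseriesD; first last.
- by move=> k _ _; rewrite -EFinM lee_fin !mulr_ge0 ?mass_ge0.
- by move=> k _ _; rewrite lee_fin mulr_ge0 ?mass_ge0 ?bin_weight_ge0.
apply: lee_nneseries => k; first by rewrite lee_fin mass_ge0.
move=> _; rewrite -EFinM -EFinD lee_fin mulrA -mulrDl ler_peMl ?mass_ge0//.
rewrite /bin_weight bin0 expr0 !mul1r subn0 -lerBlDr [alpha * _]mulrC.
exact: bernoulli_ineq.
Qed.

Lemma cvg_natr_inv : (n%:R^-1 : R) @[n --> \oo] --> (0 : R).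
Proof.
by rewrite -cvg_shiftS; exact: cvg_harmonic. Qed.

(** [n P(T_{1/n} X = 1)] is the expectation of X (1 - 1/n)^(X - 1), which is
dominated by X and converges to X. *)
Lemma cvg_mass_thinning1 :
  n%:R * mass (thinning n%:R^-1 mu) 1 @[n --> \oo] --> a.
Proof.
pose f (n m : nat) : R := m%:R * (1 - n%:R^-1) ^+ m.-1.
have n01 (n : nat) : 0 <= (n%:R^-1 : R) <= 1.
  rewrite invr_ge0 ler0n/=; case: n => [|n]; rewrite ?invr0//.
  by rewrite invf_le1 ?ltr0n ?ler1n.
have f0 n m : 0 <= f n m.
  by rewrite mulr_ge0// exprn_ge0// subr_ge0; have /andP[] := n01 n.
have fE n : (0 < n)%N ->
    (\int[mu]_m (f n m)%:E = (n%:R * mass (thinning n%:R^-1 mu) 1)%:E)%E.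
  move=> n0; rewrite EFinM mass_thinning// -nneseriesZl; last first.
    by move=> k _; rewrite lee_fin mulr_ge0 ?mass_ge0 ?bin_weight_ge0.
  rewrite ge0_integral_mass//; apply: eq_eseriesr => m _; rewrite -EFinM.
  congr (_%:E); rewrite /f /bin_weight bin1 expr1 subn1 !mulrA.
  by rewrite [n%:R * _]mulrC mulfK// pnatr_eq0 -lt0n.
have cvgf : (\int[mu]_m (f n m)%:E)%E @[n --> \oo] --> a%:E.
  rewrite -mean_mu; apply: (@dominated_cvg _ _ _ _ _ measurableT
    (fun n m => (f n m)%:E) (fun m => m%:R%:E) (fun m => m%:R%:E)) => //.
  - move=> m _; apply: cvg_EFin; first by near=> n.
    have c1 : 1 - (n%:R^-1 : R) @[n --> \oo] --> (1 : R).
      rewrite -[X in _ --> X]subr0; apply: cvgB; first exact: cvg_cst.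
      exact: cvg_natr_inv.
    have cX : (1 - (n%:R^-1 : R)) ^+ m.-1 @[n --> \oo] --> (1 ^+ m.-1 : R).
      exact: (cvg_comp _ _ c1 (@exprn_continuous R m.-1 1)).
    have := cvgM (cvg_cst (m%:R : R)) cX; rewrite expr1n mulr1; exact.
  - apply/integrableP; split => //.
    by under eq_integral do rewrite gee0_abs ?lee_fin//; rewrite mean_mu ltry.
  - move=> n m _; rewrite gee0_abs ?lee_fin// /f ler_piMr//.
    have /andP[x0 x1] := n01 n.
    by rewrite exprn_ile1 ?subr_ge0// lerBlDr lerDl.
have /fine_cvgP[_] := cvgf; apply: cvg_trans; apply: near_eq_cvg; near=> n.
by rewrite /= fE//; near: n; exact: nbhs_infty_gt.
Unshelve. all: by end_near. Qed.

(** [n] times the bound of [l1_rare] for the (1/n)-thinning of [mu] and the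
Poisson law of the same mean. *)
Definition rare_rate (n : nat) : R :=
  n%:R * (2 * (n%:R^-1 * a - mass (thinning n%:R^-1 mu) 1) +
          2 * (n%:R^-1 * a - pois (n%:R^-1 * a) 1)).

Lemma cvg_rare_rate : rare_rate n @[n --> \oo] --> 0.
Proof.
have cx := cvg_mass_thinning1.
have ca : n%:R^-1 * a @[n --> \oo] --> (0 : R).
  rewrite -[X in _ --> X](mul0r a).
  by apply: cvgM; [exact: cvg_natr_inv|exact: cvg_cst].
have ce : expR (- (n%:R^-1 * a)) @[n --> \oo] --> (1 : R).
  rewrite -[X in _ --> X]expR0 -[X in _ --> expR X]oppr0.
  exact: (cvg_comp _ _ (cvgN ca) (@continuous_expR R (- 0))).
have ch : 2 * (a - n%:R * mass (thinning n%:R^-1 mu) 1) +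
    2 * (a - a * expR (- (n%:R^-1 * a))) @[n --> \oo] --> (0 : R).
  rewrite [X in _ --> X](_ : 0 = 2 * (a - a) + 2 * (a - a * 1)); last by ring.
  by apply: cvgD; apply: cvgM; (try exact: cvg_cst); apply: cvgB;
    (try exact: cvg_cst) => //; apply: cvgM; (try exact: cvg_cst).
apply: cvg_trans ch; apply: near_eq_cvg; near=> n.
have n0 : n%:R != 0 :> R by rewrite pnatr_eq0 -lt0n; near: n; exact: nbhs_infty_gt.
by rewrite /rare_rate /pois expr1 factE /= divr1; field.
Unshelve. all: by end_near. Qed.


End thinning_rates.

(** * Convergence of the density *)

(* [X i] stands for X_{i+1}.  For n >= 1, on the space [Omega' n]:
   [Y n i] is T_{1/n} X_{i+1}, [Z n] is T_{n/(n+b_n)} (sum of the [Y n i])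
   and [V n] is T_{b_n/(n+b_n)} U. *)
Theorem theorem3p4 (R : realType) (a : R) (a_gt0 : 0 < a)
  (d : measure_display) (Omega : measurableType d) (P : probability Omega R)
  (X : nat -> {RV P >-> nat}) (U : {RV P >-> nat})
  (X_indep : mutually_independent P X)
  (X_ident : forall i, distribution P (X i) = distribution P (X 0%N))
  (X_mean : forall i, ('E_P[fun w => (X i w)%:R : R] = a%:E)%E)
  (X_L2 : density (distribution P (X 0%N)) (Poisson a)
            \in Lfun (Poisson a) 2%:E)
  (U_law : distribution P U = Poisson a)
  (U_indep : independent_of_family P U X)
  (b : nat -> R) (b_ge0 : forall n, (0 < n)%N -> 0 <= b n)
  (b_small : b n / n%:R @[n --> \oo] --> (0 : R))
  (b_large : b n / Num.sqrt n%:R @[n --> \oo] --> +oo)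
  (d' : nat -> measure_display) (Omega' : forall n, measurableType (d' n))
  (P' : forall n, probability (Omega' n) R)
  (Y : forall n, 'I_n -> {RV (P' n) >-> nat})
  (Z V : forall n, {RV (P' n) >-> nat})
  (Y_law : forall n (i : 'I_n), (0 < n)%N ->
     distribution (P' n) (Y n i) = thinning (n%:R^-1) (distribution P (X i)))
  (Y_indep : forall n, (0 < n)%N -> mutually_independent (P' n) (Y n))
  (Z_law : forall n, (0 < n)%N -> distribution (P' n) (Z n) =
     thinning (n%:R / (n%:R + b n)) (distribution (P' n) (sumRV (Y n))))
  (V_law : forall n, (0 < n)%N -> distribution (P' n) (V n) =
     thinning (b n / (n%:R + b n)) (distribution P U))
  (ZV_indep : forall n, (0 < n)%N -> independentRV (P' n) (Z n) (V n)) :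
  ('N[Poisson a]_1[EFin \o (fun k =>
      (density (distribution (P' n) (addRV (Z n) (V n))) (Poisson a) k - 1)%R)]
    @[n --> \oo] --> 0)%E.
Proof.
pose mu : probability nat R := distribution P (X 0%N).
have mean_mu : (\int[mu]_k (k%:R : R)%:E = a%:E)%E.
  rewrite ge0_integral_distribution//.
  by have := X_mean 0%N; rewrite unlock.
apply: (@squeeze_cvge _ _ _ _ (cst 0%E) _ (EFin \o rare_rate mu a)); first last.
- by apply: cvg_EFin; [near=> n|exact: cvg_rare_rate].
- exact: cvg_cst.
near=> n.
have n0 : (0 < n)%N by near: n; exact: nbhs_infty_gt.
rewrite Lnorm_ge0/= Lnorm1_density//.
have nR0 : 0 < n%:R :> R by rewrite ltr0n.
have bn0 := b_ge0 n n0.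
have nb0 : 0 < n%:R + b n by rewrite ltr_wpDr.
pose alpha := n%:R / (n%:R + b n); pose beta := b n / (n%:R + b n).
(* The two thinnings of Poisson(a) have means adding up to [a]. *)
have ab1 : alpha + beta = 1 by rewrite /alpha /beta -mulrDl divff ?gt_eqF.
have alpha0 : 0 <= alpha by rewrite divr_ge0// ltW.
have beta0 : 0 <= beta by rewrite divr_ge0// ltW.
have alpha01 : 0 <= alpha <= 1 by rewrite alpha0 -ab1 lerDl.
have beta01 : 0 <= beta <= 1 by rewrite beta0 -ab1 lerDr.
have inv01 : 0 <= (n%:R^-1 : R) <= 1 by rewrite invr_ge0 ler0n invf_le1 ?ler1n.
have t0 : 0 <= n%:R^-1 * a by rewrite mulr_ge0 ?invr_ge0// ltW.
have VE : mass (distribution (P' n) (V n)) = pois (beta * a).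
  rewrite -mass_thinning_Poisson// (eq_mass (V_law n n0)).
  by apply: eq_mass_thinning => //; exact: eq_mass.
have ZE : (l1 (mass (distribution (P' n) (Z n))) (pois (alpha * a)) <=
           l1 (mass (distribution (P' n) (sumRV (Y n)))) (pois a))%E.
  rewrite (eq_mass (Z_law n n0)).
  exact: (l1_thinning_pois _ alpha01 (ltW a_gt0)).
have YE : (l1 (mass (distribution (P' n) (sumRV (Y n)))) (pois a) <=
           (rare_rate mu a n)%:E)%E.
  rewrite -[X in pois X](mulVKf (lt0r_neq0 nR0)).
  apply: l1_sumRV_pois => //; first exact: Y_indep.
  move=> i; rewrite (eq_mass (Y_law n i n0)).
  rewrite (@eq_mass_thinning _ _ _ mu inv01 (eq_mass (X_ident i))).
  apply: l1_rare.
  - exact: mass_ge0.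
  - exact: nneseries_mass.
  - by move=> k; exact: pois_ge0.
  - exact: nneseries_pois.
  - exact: mass_thinning0_ge.
  - by rewrite /pois expr0 fact0 divr1 mul1r; exact: expR_ge1Dx.
have -> : mass (distribution (P' n) (addRV (Z n) (V n))) =
    convolve (mass (distribution (P' n) (Z n))) (pois (beta * a)).
  by rewrite -VE; apply/funext; apply: mass_addRV; exact: ZV_indep.
have -> : pois a = convolve (pois (alpha * a)) (pois (beta * a)).
  by apply/funext => k; rewrite convolve_pois -mulrDl ab1 mul1r.
apply: le_trans (le_trans ZE YE); apply: l1_convolver.
- by move=> k; rewrite pois_ge0// mulr_ge0// ltW.
- by rewrite nneseries_pois// mulr_ge0// ltW.
- exact: mass_ge0.
- by move=> k; rewrite pois_ge0// mulr_ge0// ltW.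
Unshelve. all: by end_near. Qed.
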